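(* Let $H$ be a weakly norming graph. Then for each $\varepsilon\in(0,1)$: (a) $\mathfrak{d}_{r(H)}(\varepsilon)=0$, and (b) $\mathfrak{s}_{r(H)}(\varepsilon)\ge \tfrac12\varepsilon$.
   Context: Graphs are finite and simple. Let $\Omega$ be a standard Borel space with an atomless probability measure $\nu$. For a graph $H$ on vertex set $\{v_1,\dots,v_n\}$ and a symmetric measurable $W:\Omega^2\to\mathbb{R}$, set $t(H,W):=\int_{\Omega^n}\prod_{\{v_i,v_j\}\in E(H)}W(x_i,x_j)\,d\nu^{\otimes n}(x_1,\dots,x_n)$. Let $\mathcal{W}_{r(H)}$ be the set of symmetric measurable $W:\Omega^2\to\mathbb{R}$ for which $t(H,|W|)$ is defined and finite, and $\|W\|_{r(H)}:=t(H,|W|)^{1/e(H)}$; $H$ is weakly norming if this is a norm on $\mathcal{W}_{r(H)}$. For the normed space $X=(\mathcal{W}_{r(H)},\|\cdot\|_{r(H)})$, $\mathfrak{d}_{r(H)}(\varepsilon):=\inf\{1-\|\tfrac{x+y}{2}\| : x,y\in X,\ \|x-y\|\ge\varepsilon,\ \|x\|=\|y\|=1\}$ and $\mathfrak{s}_{r(H)}(\varepsilon):=\sup\{\tfrac12(\|x+y\|+\|x-y\|-2): x,y\in X,\ \|x\|=1,\ \|y\|=\varepsilon\}$, where $\|\cdot\|=\|\cdot\|_{r(H)}$. *)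

(* Defs.v *)
(* MathComp-Analysis *)
From HB Require Import structures.
From mathcomp Require Import all_boot all_order all_algebra.
From mathcomp Require Import all_classical all_reals all_analysis.

Set Implicit Arguments.
Unset Strict Implicit.
Unset Printing Implicit Defensive.

Import Order.TTheory GRing.Theory Num.Theory.
Import numFieldNormedType.Exports.

Local Open Scope classical_set_scope.
Local Open Scope ring_scope.

(* The sigma-algebra of T is the Borel sigma-algebra of a Polish (separable,
   completely metrizable) topology. That topology is carried by a space X in
   bijection with T, so that T itself needs no topological structure. *)
Definition standard_borel (R : realType) (d : measure_display)
    (T : measurableType d) : Prop :=
  exists (X : completePseudoMetricType R) (f : T -> X),
    [/\ hausdorff_space X,
        exists2 S : set X, countable S & dense S,
        bijective f &
        forall A : set T, measurable A <->
          exists2 B : set X, <<s [set U : set X | open U] >> B & A = f @^-1` B].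

Definition atomless (R : realType) (d : measure_display)
    (T : measurableType d) (nu : {measure set T -> \bar R}) : Prop :=
  forall A : set T, measurable A -> (0 < nu A)%E ->
    exists B : set T,
      [/\ measurable B, B `<=` A, (0 < nu B)%E & (nu B < nu A)%E].

Section product_power.
Context (R : realType) (d : measure_display) (T : measurableType d).

Definition cons_pair (n : nat) (p : T * n.-tuple T) : n.+1.-tuple T :=
  [tuple of p.1 :: p.2].

Lemma measurable_cons_pair (n : nat) :
  measurable_fun [set: T * n.-tuple T] (@cons_pair n).
Proof. exact: measurable_cons. Qed.

HB.instance Definition _ (n : nat) :=
  isMeasurableFun.Build _ _ _ _ (@cons_pair n) (@measurable_cons_pair n).

Fixpoint power_measure (nu : probability T R) (n : nat) :
    probability (n.-tuple T) R :=
  if n is m.+1 then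
    distribution (nu \x power_measure nu m)%E (@cons_pair m)
  else dirac [tuple].

Lemma power_measure_box (nu : probability T R) (n : nat) (A : 'I_n -> set T) :
  (forall i, measurable (A i)) ->
  power_measure nu n [set x | forall i, A i (tnth x i)] =
  (\prod_(i < n) nu (A i))%E.
Proof.
elim: n A => [|n IHn] A mA.
  by rewrite big_ord0 /= diracE mem_set // => -[].
rewrite big_ord_recl -(IHn (fun i => A (lift ord0 i))) //=.
rewrite /distribution /pushforward.
rewrite (_ : _ @^-1` _ = A ord0 `*`
  [set x | forall i, A (lift ord0 i) (tnth x i)]).
  rewrite product_measure1E //.
  rewrite (_ : [set x | _] =
    \big[setI/setT]_(i < n) ((@tnth _ T ^~ i) @^-1` A (lift ord0 i))).
    apply: bigsetI_measurable => i _; rewrite -[X in measurable X]setTI.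
    exact: measurable_tnth.
  rewrite -bigcap_seq; apply/seteqP; split=> [x /= Ax i _|x /= Ax i].
    exact: Ax.
  by apply: (Ax i); rewrite /= mem_index_enum.
apply/seteqP; split => [[a x] /= Aax|[a x] /= [Aa Ax] i].
  split; first by have := Aax ord0; rewrite tnth0.
  by move=> i; have := Aax (lift ord0 i); rewrite tnthS.
by case: (unliftP ord0 i) => [j|] ->; rewrite ?tnthS ?tnth0.
Qed.

End product_power.

Record sgraph (n : nat) := SGraph {
  adj :> rel 'I_n;
  adj_sym : symmetric adj;
  adj_irrefl : irreflexive adj
}.

(* The edge {v_i, v_j} is represented by the pair (i, j) with i < j. *)
Definition edges (n : nat) (H : sgraph n) : {set 'I_n * 'I_n} :=
  [set p : 'I_n * 'I_n | (p.1 < p.2)%N && H p.1 p.2]%SET.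

Section graph_norm.
Context (R : realType) (d : measure_display) (T : measurableType d).
Context (nu : probability T R) (n : nat) (H : sgraph n).

Definition hom_density (W : T * T -> R) : \bar R :=
  (\int[power_measure nu n]_x
     (\prod_(p in edges H) W (tnth x p.1, tnth x p.2))%:E)%E.

Definition graph_space : set (T * T -> R) :=
  [set W : T * T -> R | [/\ measurable_fun [set: T * T] W,
               forall x y, W (x, y) = W (y, x) &
               (hom_density (fun z => `|W z|%R) < +oo)%E]].

Definition graph_norm (W : T * T -> R) : R :=
  fine (hom_density (fun z => `|W z|)) `^ (#|edges H|%:R)^-1.

(* As for L^p spaces, functions equal almost everywhere are identified, so
   definiteness holds up to null sets. If H has no edge, graph_norm is
   constantly 1 and homogeneity fails. *)
Record weakly_norming : Prop := WeaklyNorming {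
  graph_space0 : graph_space (fun=> 0);
  graph_spaceD : forall f g, graph_space f -> graph_space g ->
    graph_space (fun z => f z + g z);
  graph_spaceZ : forall (c : R) f, graph_space f ->
    graph_space (fun z => c * f z);
  graph_norm_triangle : forall f g, graph_space f -> graph_space g ->
    graph_norm (fun z => f z + g z) <= graph_norm f + graph_norm g;
  graph_normZ : forall (c : R) f, graph_space f ->
    graph_norm (fun z => c * f z) = `|c| * graph_norm f;
  graph_norm_definite : forall f, graph_space f -> graph_norm f = 0 ->
    {ae (nu \x nu)%E, forall z, f z = 0}
}.

End graph_norm.

(* Moduli of a function space V with norm N; the infimum and supremum are taken
   in \bar R, where ereal_inf set0 = +oo and ereal_sup set0 = -oo. *)
Section moduli.
Context (R : realType) (S : Type) (V : set (S -> R)) (N : (S -> R) -> R).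

Definition convexity_modulus (eps : R) : \bar R :=
  ereal_inf [set r | exists x y : S -> R,
    [/\ V x, V y, eps <= N (fun z => x z - y z), N x = 1 /\ N y = 1 &
        r = (1 - N (fun z => (x z + y z) / 2))%:E]].

Definition smoothness_modulus (eps : R) : \bar R :=
  ereal_sup [set r | exists x y : S -> R,
    [/\ V x, V y, N x = 1, N y = eps &
        r = (2^-1 * (N (fun z => x z + y z) +
                     N (fun z => x z - y z) - 2))%:E]].

End moduli.

(* Main.v *)
(* Let [s_k (x, y)] be the product over [l < k] of [(-1) ^ (a_l x * a_l y)], for
   independent fair bits [a_0, a_1, ...] on Omega, which exist by atomlessness.
   For a nonempty set [F] of edges, the expectation of the product of [s_k] over
   [F] is the k-th power of a number in ]-1, 1[, hence vanishes as [k] grows.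
   Expanding [|a + b s_k| = a' + b' s_k] over the edges, only the constant term
   survives, so [s_k] is invisible to the norm of nonnegative functions and
   [|| a + b s_k ||] tends to [a' = (|a + b| + |a - b|) / 2]. Hence, if [y_k] is
   the normalization of [1 + s_k], then [|| y_k + a ||] tends to
   [max (1 + a) 1] for [a >= -1]: the pair [y_k], [1] refutes uniform convexity,
   and the pair [y_k], [eps] bounds the modulus of smoothness from below. *)
Require Import Defs.
From mathcomp Require Import all_boot all_order all_algebra.
From mathcomp Require Import all_classical all_reals all_analysis.
From mathcomp Require Import measurable_realfun lra.

Set Implicit Arguments.
Unset Strict Implicit.
Unset Printing Implicit Defensive.

Import Order.TTheory GRing.Theory Num.Theory.
Import numFieldNormedType.Exports.

Local Open Scope classical_set_scope.
Local Open Scope ring_scope.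

(** * Sierpinski's theorem and fair bits on an atomless probability space *)

Section atomless_probability.
Context (R : realType) (d : measure_display) (T : measurableType d).
Context (nu : probability T R) (nu_atomless : atomless nu).

Let m (A : set T) : R := fine (nu A).

Let mE A : measurable A -> nu A = (m A)%:E.
Proof. by move=> mA; rewrite /m fineK// fin_num_measure. Qed.

Let m0 : m set0 = 0.
Proof. by rewrite /m measure0. Qed.

Let mD A B : measurable A -> measurable B -> B `<=` A ->
  m (A `\` B) = m A - m B.
Proof.
move=> mA mB BA; apply: EFin_inj; rewrite EFinB -!mE//; last exact: measurableD.
by rewrite measureD// ?ltey_eq ?fin_num_measure// setIidr.
Qed.

Let mU A B : measurable A -> measurable B -> A `&` B = set0 ->
  m (A `|` B) = m A + m B.
Proof.
move=> mA mB AB; apply: EFin_inj; rewrite EFinD -!mE//; last exact: measurableU.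
by rewrite measureU.
Qed.

Let m_le A B : measurable A -> measurable B -> A `<=` B -> m A <= m B.
Proof. by move=> mA mB AB; rewrite -lee_fin -!mE// le_measure// inE. Qed.

Let m_atomless A : measurable A -> 0 < m A ->
  exists B, [/\ measurable B, B `<=` A, 0 < m B & m B < m A].
Proof.
move=> mA A0; have [|B [mB BA B0 BltA]] := nu_atomless mA.
  by rewrite -lte_fin -mE in A0.
by exists B; split; rewrite // -lte_fin -!mE.
Qed.

(** Atomlessness splits a set into two parts of positive measure, one of which has at most half the
    measure; this halving is iterated until the bound [e] is reached. *)
Lemma atomless_small A (e : R) : measurable A -> (0 < nu A)%E -> 0 < e ->
  exists B, [/\ measurable B, B `<=` A, (0 < nu B)%E & (nu B <= e%:E)%E].
Proof.
move=> mA A0 e0.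
have halve B : measurable B -> 0 < m B -> exists C,
    [/\ measurable C, C `<=` B, 0 < m C & m C <= m B / 2].
  move=> mB B0; have [C [mC CB C0 CltB]] := m_atomless mB B0.
  have [CleB|CgtB] := leP (m C) (m B / 2); first by exists C.
  exists (B `\` C); split; [exact: measurableD|exact: subDsetl| |].
  - by rewrite mD// subr_gt0.
  - by rewrite mD//; lra.
have [k Ak] : exists k, m A * 2^-1 ^+ k < e.
  have : (m A * 2^-1 ^+ k) @[k --> \oo] --> 0.
    rewrite -[X in _ --> X](mulr0 (m A)); apply: cvgM; first exact: cvg_cst.
    apply: cvg_expr.
    by rewrite ger0_norm; lra.
  by move=> /cvgr_lt /(_ _ e0) [k _ /(_ k (leqnn k))]; exists k.
have : exists B, [/\ measurable B, B `<=` A, 0 < m B & m B <= m A * 2^-1 ^+ k].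
  elim: k {Ak} => [|k [B [mB BA B0 Bk]]].
    by exists A; split; rewrite ?expr0 ?mulr1// -lte_fin -mE.
  have [C [mC CB C0 Ck]] := halve _ mB B0.
  exists C; split=> //; first exact: subset_trans BA.
  by rewrite exprSr mulrA (le_trans Ck)// ler_pM2r.
case=> B [mB BA B0 Bk]; exists B; rewrite mE//; split=> //.
by rewrite lee_fin (le_trans Bk)// ltW.
Qed.

(* Sierpinski's theorem by greedy exhaustion: each step adds to the current
   set an admissible piece of at least half the largest possible measure. *)
Lemma atomless_intermediate A (c : R) : measurable A ->
  0 <= c -> (c%:E <= nu A)%E ->
  exists B, [/\ measurable B, B `<=` A & nu B = c%:E].
Proof.
move=> mA c0; rewrite mE// lee_fin => cA.
pose adm B E := [/\ measurable E, E `<=` A `\` B & m B + m E <= c].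
have adm0 B : m B <= c -> adm B set0.
  by move=> Bc; split=> //; rewrite m0 addr0.
(* The conditions on [B] come after the existential so that [choice] yields a total function [g]. If
   the supremum of the admissible measures is positive, some piece exceeds half of it; otherwise the
   empty set does. *)
have greedy B : exists E, measurable B -> m B <= c ->
    adm B E /\ forall E', adm B E' -> m E' <= 2 * m E.
  have [[mB Bc]|nB] := pselect (measurable B /\ m B <= c); last first.
    by exists set0 => mB Bc; exfalso; apply: nB.
  have supS : has_sup [set m E | E in adm B].
    split; first by exists (m set0), set0; rewrite //; exact: adm0.
    by exists (c - m B) => _ [E [_ _ BE] <-]; lra.
  have ubS E' : adm B E' -> m E' <= sup [set m E | E in adm B].
    by move=> E'B; apply: sup_upper_bound => //; exists E'.
  have [s0|s0] := leP (sup [set m E | E in adm B]) 0.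
    exists set0 => _ _; split; first exact: adm0.
    by move=> E' /ubS E's; rewrite m0 mulr0 (le_trans E's).
  have [|_ [E EB <-] sE] :=
    @sup_adherent _ _ (sup [set m E | E in adm B] / 2) _ supS; first by lra.
  by exists E => _ _; split=> // E' /ubS E's; lra.
have [g gP] := choice greedy.
pose B_ k := iter k (fun B => B `|` g B) set0.
have B_P k : [/\ measurable (B_ k), B_ k `<=` A & m (B_ k) <= c].
  elim: k => [|k [mB BA Bc]]; first by rewrite /B_/= m0; split.
  have [[mg gA gc] _] := gP _ mB Bc.
  split; first exact: measurableU.
  - by move=> x [/BA//|/gA []].
  - rewrite /= mU//; apply/seteqP; split=> x //= [xB /gA[_]]; exact.
have mB_ k : measurable (B_ k) by have [] := B_P k.
have ndB : nondecreasing_seq B_.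
  by apply/nondecreasing_seqP => k; rewrite subsetEset; exact: subsetUl.
pose B := \bigcup_k B_ k.
have mB : measurable B by exact: bigcup_measurable.
have BA : B `<=` A by move=> x [k _]; have [_ + _] := B_P k; exact.
have Bc : m B <= c.
  rewrite -lee_fin -mE//.
  have Blim := @nondecreasing_cvg_mu _ _ _ nu _ mB_ mB ndB.
  rewrite -(cvg_lim _ Blim)//; apply: lime_le.
    by apply/cvg_ex; exists (nu B).
  by near=> k; rewrite /= mE// lee_fin; have [] := B_P k.
exists B; split=> //; rewrite mE//; congr EFin; apply/eqP.
rewrite eq_le Bc/= leNgt; apply/negP => Bltc.
(* If the union [B] fell short of [c], a small piece [E] of the remainder would be admissible at
   every stage. Each greedy step would then add at least [m E / 2], and the measures would outgrow
   [c]. *)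
have [|||E [mE' EAB E0 Ec]] := @atomless_small (A `\` B) (c - m B).
- exact: measurableD.
- rewrite mE; last exact: measurableD.
  by rewrite mD// lte_fin subr_gt0 (lt_le_trans Bltc).
- by rewrite subr_gt0.
move: E0 Ec; rewrite mE// lte_fin lee_fin => E0 Ec.
have growth k : k%:R * (m E / 2) <= m (B_ k).
  elim: k => [|k IHk]; first by rewrite mul0r /m fine_ge0.
  have [_ BkA Bkc] := B_P k.
  have [[mg gA gc] gmax] := gP _ (mB_ k) Bkc.
  have BkB : m (B_ k) <= m B by apply: m_le => // x Bx; exists k.
  have /gmax gE : adm (B_ k) E.
    split=> //; last by lra.
    by move=> x /EAB[Ax nBx]; split=> // Bkx; apply: nBx; exists k.
  rewrite /= mU//; last first.
    by apply/seteqP; split=> x //= [xB /gA[_]]; exact.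
  by rewrite -natr1 mulrDl; lra.
have [k kP] : exists k : nat, c / (m E / 2) < k%:R.
  by exists (Num.truncn (c / (m E / 2))).+1; exact: truncnS_gt.
have [_ _] := B_P k; apply/negP; rewrite -ltNge.
by rewrite (lt_le_trans _ (growth k))// -ltr_pdivrMr// divr_gt0.
Unshelve. all: by end_near. Qed.

(** Induction on [k]: half of each fibre of the code so far is selected, and membership in that half
    is the next bit. Equidistribution over all words expresses that the bits are independent and
    fair. *)
Lemma fair_code (k : nat) : exists a : T -> k.-tuple bool, forall t,
  measurable (a @^-1` [set t]) /\ nu (a @^-1` [set t]) = (2^-1 ^+ k)%:E.
Proof.
elim: k => [|k [a aP]].
  exists (fun=> [tuple]) => t; rewrite (_ : _ @^-1` _ = setT).
    by rewrite probability_setT expr0.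
  by apply/seteqP; split=> // x _; exact: esym (tuple0 t).
have /choice[B BP] t : exists B, [/\ measurable B, B `<=` a @^-1` [set t] &
    nu B = (2^-1 ^+ k.+1)%:E].
  have [mat at_] := aP t; apply: atomless_intermediate => //.
  by rewrite at_ lee_fin exprS ler_piMl// invf_le1// ler1n.
exists (fun x => [tuple of `[< B (a x) x >] :: a x]) => t.
case/tupleP: t => b t; have [mat at_] := aP t; have [mB Bat Bk] := BP t.
have preim : (fun x => [tuple of `[< B (a x) x >] :: a x]) @^-1`
    [set [tuple of b :: t]] = if b then B t else a @^-1` [set t] `\` B t.
  apply/seteqP; split=> x /=.
    move=> /(congr1 val)/= [<- /val_inj at1].
    by rewrite at1; case: asboolP.
  case: b => [Btx|[/= -> nBtx]]; last by apply: val_inj; rewrite /= asboolF.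
  have axt := Bat _ Btx; rewrite /= in axt.
  by apply: val_inj; rewrite /= axt asboolT.
rewrite preim; case: b {preim}; first by split.
split; first exact: measurableD.
rewrite mE; last exact: measurableD.
rewrite mD// /m at_ Bk /= exprS; congr EFin; lra.
Qed.

End atomless_probability.

(** * Sign kernels on binary words and their averages *)

Section code_sign.
Context (R : realType).

(** The sign [s_k] read on words: the Walsh character of [F_2 ^ k], that is, -1 to the power of the
    inner product of [s] and [t]. *)
Definition code_sign (k : nat) (s t : k.-tuple bool) : R :=
  \prod_(l < k) (-1) ^+ (tnth s l && tnth t l).

Lemma code_signC k (s t : k.-tuple bool) : code_sign s t = code_sign t s.
Proof. by apply: eq_bigr => l _; rewrite andbC. Qed.

Lemma code_sign_pm1 k (s t : k.-tuple bool) :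
  code_sign s t = 1 \/ code_sign s t = -1.
Proof.
apply: (big_ind (fun x => x = 1 \/ x = -1)) => [|x y [->|->] [->|->]|l _];
  rewrite ?mulr1 ?mulrN1 ?opprK; auto.
by case: (_ && _); auto.
Qed.

Context (n : nat).

(** The expectation of the product of one-bit signs over [F], when each vertex carries an
    independent fair bit. *)
Definition bit_average (F : {set 'I_n * 'I_n}) : R :=
  2^-1 ^+ n * \sum_(b : {ffun 'I_n -> bool})
    \prod_(p in F) (-1) ^+ (b p.1 && b p.2).

Lemma bit_average0 : bit_average finset.set0 = 1.
Proof.
rewrite /bit_average; under eq_bigr => b _ do rewrite big_set0.
by rewrite sumr_const card_ffun card_bool card_ord exprVn natrX mulVf.
Qed.

(* The exponent is a nonzero quadratic form over F_2: it is even on the zero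
   assignment and odd on the indicator of the endpoints of a single edge. *)
Lemma bit_average_lt1 (F : {set 'I_n * 'I_n}) :
  (forall p, p \in F -> (p.1 < p.2)%N) -> F != finset.set0 ->
  `|bit_average F| < 1.
Proof.
move=> Flt /finset.set0Pn[[u v] Fuv].
have uv := Flt _ Fuv; rewrite /= in uv.
pose sg (b : {ffun 'I_n -> bool}) : R :=
  \prod_(p in F) (-1) ^+ (b p.1 && b p.2).
pose b0 : {ffun 'I_n -> bool} := [ffun=> false].
pose b1 : {ffun 'I_n -> bool} := [ffun i => (i == u) || (i == v)].
have sg0 : sg b0 = 1 by rewrite /sg big1// => p _; rewrite !ffunE.
have sg1 : sg b1 = -1.
  rewrite /sg (bigD1 (u, v))//= !ffunE !eqxx orbT/= expr1 big1 ?mulr1//.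
  move=> [i j] /andP[Fij ijuv]; have ij := Flt _ Fij; rewrite /= in ij.
  rewrite !ffunE /=.
  suff /negbTE-> : ~~ (((i == u) || (i == v)) && ((j == u) || (j == v))) by [].
  apply/negP => /andP[/orP[]/eqP iE /orP[]/eqP jE]; subst i j.
  - by rewrite ltnn in ij.
  - by rewrite eqxx in ijuv.
  - by rewrite ltnNge (ltnW uv) in ij.
  - by rewrite ltnn in ij.
have sgn b : `|sg b| = 1.
  by rewrite normr_prod big1// => p _; rewrite normrX normrN1 expr1n.
have b10 : b1 != b0.
  by apply/eqP => /ffunP/(_ u); rewrite !ffunE eqxx.
have -> : bit_average F = 2^-1 ^+ n * \sum_b sg b by [].
rewrite normrM ger0_norm ?exprn_ge0// exprVn mulrC ltr_pdivrMr ?exprn_gt0//.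
(* The terms at [b0] and [b1] cancel, so the remaining signs sum to at most [2 ^ n - 2] in absolute
   value. *)
rewrite mul1r (bigD1 b0)//= (bigD1 b1)//= sg0 sg1 addrA subrr add0r.
apply: (le_lt_trans (ler_norm_sum _ _ _)).
under eq_bigr => b _ do rewrite sgn.
have -> : 2 ^+ n = \sum_(b : {ffun 'I_n -> bool}) (1 : R).
  by rewrite sumr_const card_ffun card_bool card_ord natrX.
rewrite [ltRHS](bigD1 b0)//= [X in _ < _ + X](bigD1 b1)//=.
by rewrite addrA ltrDr addr_gt0.
Qed.

(** The positions in a word contribute independently. The bijection [tr] transposes [k] assignments
    of one bit to each vertex into one assignment of [k]-bit words, and the sum factors over the
    positions. *)
Lemma code_average k (F : {set 'I_n * 'I_n}) :
  2^-1 ^+ k ^+ n * \sum_(c : {ffun 'I_n -> k.-tuple bool})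
    \prod_(p in F) code_sign (c p.1) (c p.2) = bit_average F ^+ k.
Proof.
rewrite /bit_average exprMn exprAC; congr (_ * _).
rewrite -[in RHS](card_ord k) -prodr_const bigA_distr_bigA/=.
pose tr (g : {ffun 'I_k -> {ffun 'I_n -> bool}}) :
    {ffun 'I_n -> k.-tuple bool} := [ffun i => [tuple g l i | l < k]].
rewrite (reindex tr)/=; last first.
  exists (fun c : {ffun 'I_n -> k.-tuple bool} =>
    [ffun l : 'I_k => [ffun i : 'I_n => tnth (c i) l]]).
  - move=> g _; apply/ffunP => l; apply/ffunP => i.
    by rewrite !ffunE tnth_mktuple.
  - move=> c _; apply/ffunP => i; apply: eq_from_tnth => l.
    by rewrite !ffunE tnth_mktuple !ffunE.
apply: eq_bigr => g _; rewrite exchange_big/=; apply: eq_bigr => p _.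
by apply: eq_bigr => l _; rewrite !ffunE !tnth_mktuple.
Qed.

Lemma code_density_cvg (E : {set 'I_n * 'I_n}) (a b : R) :
  (forall p, p \in E -> (p.1 < p.2)%N) ->
  2^-1 ^+ k ^+ n * (\sum_(c : {ffun 'I_n -> k.-tuple bool})
    \prod_(p in E) (a + b * code_sign (c p.1) (c p.2))) @[k --> \oo]
  --> a ^+ #|E|.
Proof.
move=> Elt.
(* [C J] is the coefficient of the term that takes the sign exactly at the pairs in [J]. The product
   runs over all pairs, as in [bigA_distr]: a pair outside [E] contributes the factor [0 * s + 1],
   so [C J] vanishes unless [J] lies in [E]. *)
pose C (J : {set 'I_n * 'I_n}) : R := \prod_p
  (if p \in J then if p \in E then b else 0 else if p \in E then a else 1).
have -> : (fun k => 2^-1 ^+ k ^+ n * (\sum_(c : {ffun 'I_n -> k.-tuple bool})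
    \prod_(p in E) (a + b * code_sign (c p.1) (c p.2)))) =
    fun k => \sum_(J : {set 'I_n * 'I_n}) C J * bit_average J ^+ k.
  apply/funext => k; under [RHS]eq_bigr => J _ do
    rewrite -code_average mulrCA mulr_sumr.
  rewrite -mulr_sumr exchange_big/=; congr (_ * _); apply: eq_bigr => c _.
  pose s p := code_sign (c p.1) (c p.2).
  rewrite big_mkcond/=.
  rewrite (eq_bigr (fun p => (if p \in E then b else 0) * s p +
      (if p \in E then a else 1))); last first.
    by move=> p _; case: ifP => _; rewrite ?mul0r ?add0r// addrC.
  rewrite bigA_distr/=; apply: eq_bigr => J _.
  rewrite [X in _ * X]big_mkcond/= -big_split/=; apply: eq_bigr => p _.
  by case: ifP => _; rewrite ?mulr1.
have -> : a ^+ #|E| = \sum_(J : {set 'I_n * 'I_n})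
    (if J == finset.set0 then a ^+ #|E| else 0).
  by rewrite -big_mkcond/= big_pred1_eq.
apply: cvg_big => [|J _]; first exact: add_continuous.
case: eqP => [->|/eqP J0].
  rewrite bit_average0; under eq_fun do rewrite expr1n mulr1.
  rewrite (_ : C _ = a ^+ #|E|); first exact: cvg_cst.
  rewrite /C; under eq_bigr => p _ do rewrite inE.
  by rewrite -big_mkcond prodr_const.
have [JE|/fintype.subsetPn[p pJ pE]] := boolP (J \subset E); last first.
  rewrite (_ : C J = 0); first by under eq_fun do rewrite mul0r; exact: cvg_cst.
  by rewrite /C (bigD1 p)//= pJ (negbTE pE) mul0r.
rewrite -[X in _ --> X](mulr0 (C J)); apply: cvgM; first exact: cvg_cst.
apply: cvg_expr.
by apply: bit_average_lt1 => // p /(fintype.subsetP JE)/Elt.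
Qed.

End code_sign.

(** * Integration and measurability of functions of a finite code *)

Section code_integral.
Context (R : realType) (d : measure_display) (T : measurableType d).
Context (nu : probability T R) (K : finType) (a : T -> K) (q : R).
Context (aP : forall t,
  measurable (a @^-1` [set t]) /\ nu (a @^-1` [set t]) = q%:E).

(** The integrand is a simple function, constant on boxes of fibres of [a], and each box has measure
    [q ^ n]. *)
Lemma integral_power_measure_code n (Phi : {ffun 'I_n -> K} -> R) :
  (forall c, 0 <= Phi c) ->
  (\int[power_measure nu n]_x (Phi [ffun i => a (tnth x i)])%:E)%E =
  (q ^+ n * \sum_c Phi c)%:E.
Proof.
move=> Phi0.
pose box (c : {ffun 'I_n -> K}) : set (n.-tuple T) :=
  [set x | forall i, (a @^-1` [set c i]) (tnth x i)].
have mbox c : measurable (box c).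
  rewrite (_ : box c =
    \bigcap_(i in [set: 'I_n]) ((@tnth _ T ^~ i) @^-1` (a @^-1` [set c i]))).
    apply: fin_bigcap_measurable => // i _; rewrite -[X in measurable X]setTI.
    by apply: measurable_tnth => //; exact: (aP (c i)).1.
  by apply/seteqP; split=> x /= cx i; [move=> _; exact: cx|exact: cx].
have nubox c : power_measure nu n (box c) = (q ^+ n)%:E.
  rewrite (power_measure_box nu (A := fun i => a @^-1` [set c i])); last first.
    by move=> i; exact: (aP (c i)).1.
  under eq_bigr => i _ do rewrite (aP (c i)).2.
  by rewrite prodEFin prodr_const card_ord.
transitivity (\int[power_measure nu n]_x
    \sum_(c : {ffun 'I_n -> K}) (Phi c * \1_(box c) x)%:E)%E.
  apply: eq_integral => x _; rewrite sumEFin; congr EFin.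
  set cx := [ffun i => a (tnth x i)].
  rewrite (bigD1 cx)//= big1 ?addr0.
    by rewrite indicE mem_set ?mulr1// => i /=; rewrite ffunE.
  move=> c ccx; rewrite indicE memNset ?mulr0// => xc.
  by move/eqP: ccx; apply; apply/ffunP => i; rewrite ffunE; have /= <- := xc i.
rewrite ge0_integral_sum//=; last 2 first.
- move=> c; apply/measurable_EFinP; apply: measurable_funM.
    exact: measurable_cst.
  exact: measurable_indic.
- by move=> c x _; rewrite lee_fin mulr_ge0.
rewrite mulr_sumr -sumEFin; apply: eq_bigr => c _.
under eq_integral do rewrite EFinM.
rewrite ge0_integralZl_EFin//; last first.
  by apply/measurable_EFinP; exact: measurable_indic.
by rewrite integral_indic// setIT [X in (_ * X)%E](nubox c) -EFinM mulrC.
Qed.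

Lemma measurable_code2 (phi : K -> K -> R) :
  measurable_fun [set: T * T] (fun z => phi (a z.1) (a z.2)).
Proof.
pose box (c : K * K) : set (T * T) :=
  (a @^-1` [set c.1]) `*` (a @^-1` [set c.2]).
rewrite (_ : (fun z => _) =
  fun z => \sum_(c : K * K) phi c.1 c.2 * \1_(box c) z); last first.
  apply/funext => z; rewrite (bigD1 (a z.1, a z.2))//= big1 ?addr0.
    by rewrite indicE mem_set ?mulr1.
  move=> [s t] st; rewrite indicE memNset ?mulr0//= => -[/= sE tE].
  by rewrite sE tE eqxx in st.
apply: measurable_sum => c; apply: measurable_funM; first exact: measurable_cst.
apply: measurable_indic.
by apply: measurableX; [exact: (aP c.1).1|exact: (aP c.2).1].
Qed.

End code_integral.

(** [powR] treats base 0 separately, but near a positive [x] it agrees with [expR (p * ln y)]. *)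
Lemma powR_continuous (R : realType) (p x : R) : 0 < x ->
  {for x, continuous (fun y => y `^ p)}.
Proof.
move=> x0.
have powE : {near x, (fun y => expR (p * ln y)) =1 (fun y => y `^ p)}.
  by near=> y; rewrite /powR gt_eqF//; near: y; exact: lt_nbhsr.
apply: cvg_trans (near_eq_cvg powE) _.
rewrite /powR gt_eqF//; apply: continuous_cvg; first exact: continuous_expR.
by apply: cvgM; [exact: cvg_cst|exact: continuous_ln].
Unshelve. all: by end_near. Qed.

(** * Graph norms of constants perturbed by random signs *)

Section sign_perturbation.
Context (R : realType) (d : measure_display) (T : measurableType d).
Context (nu : probability T R) (nu_atomless : atomless nu).
Context (n : nat) (H : sgraph n).

Let edges_lt p : p \in edges H -> (p.1 < p.2)%N.
Proof. by rewrite inE => /andP[]. Qed.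

(** Every function on the two points 1 and -1 is affine; the coefficients are the half-sum and
    half-difference of its values. *)
Let normr_affine (a b s : R) : s = 1 \/ s = -1 ->
  `|a + b * s| = (`|a + b| + `|a - b|) / 2 + (`|a + b| - `|a - b|) / 2 * s.
Proof. by case=> ->; rewrite ?mulrN !mulr1; lra. Qed.

(** The integrand depends only on the words of the vertices, so the integral is a finite average;
    [normr_affine] removes the absolute values. *)
Lemma hom_density_code k (c : T -> k.-tuple bool) (a b : R) :
  (forall t, measurable (c @^-1` [set t]) /\
     nu (c @^-1` [set t]) = (2^-1 ^+ k)%:E) ->
  hom_density nu H (fun z => `|a + b * code_sign R (c z.1) (c z.2)|) =
  (2^-1 ^+ k ^+ n * \sum_(t : {ffun 'I_n -> k.-tuple bool})
     \prod_(p in edges H) ((`|a + b| + `|a - b|) / 2 +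
       (`|a + b| - `|a - b|) / 2 * code_sign R (t p.1) (t p.2)))%:E.
Proof.
move=> cP; rewrite -(integral_power_measure_code cP); last first.
  move=> t; apply: prodr_ge0 => p _.
  by rewrite -normr_affine//; exact: code_sign_pm1.
apply: eq_integral => x _; congr EFin; apply: eq_bigr => p _.
by rewrite !ffunE normr_affine//; exact: code_sign_pm1.
Qed.

Lemma sign_perturbation : (0 < #|edges H|)%N ->
  exists s : nat -> T * T -> R, forall a b : R,
    (forall k, graph_space nu H (fun z => a + b * s k z)) /\
    (0 < `|a + b| + `|a - b| ->
     graph_norm nu H (fun z => a + b * s k z) @[k --> \oo] -->
       (`|a + b| + `|a - b|) / 2).
Proof.
move=> e_gt0.
pose c k := sval (cid (fair_code nu_atomless k)).
have cP k := svalP (cid (fair_code nu_atomless k)).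
exists (fun k z => code_sign R (c k z.1) (c k z.2)) => a b.
split=> [k|ab_gt0].
  split=> [|x y|]; last by rewrite hom_density_code ?ltry.
  - exact: (measurable_code2 (cP k) (fun s t => a + b * code_sign R s t)).
  - by rewrite /= code_signC.
set v := (`|a + b| + `|a - b|) / 2.
have v_gt0 : 0 < v by rewrite divr_gt0.
have root : (v ^+ #|edges H|) `^ (#|edges H|%:R)^-1 = v.
  by rewrite -powR_mulrn ?ltW// -powRrM mulfV ?powRr1 ?ltW// pnatr_eq0 -lt0n.
rewrite -[X in _ --> X]root /graph_norm.
under eq_fun => k do rewrite (hom_density_code a b (cP k))/=.
have /= dens :=
  @code_density_cvg R n (edges H) v ((`|a + b| - `|a - b|) / 2) edges_lt.
apply: (cvg_comp _ (fun y => y `^ (#|edges H|%:R)^-1) dens).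
by apply: powR_continuous; rewrite exprn_gt0.
Qed.

End sign_perturbation.

(** * Unit vectors built from the random signs *)

Section weakly_norming.
Context (R : realType) (d : measure_display) (T : measurableType d).
Context (nu : probability T R) (nu_atomless : atomless nu).
Context (n : nat) (H : sgraph n) (H_wn : weakly_norming nu H).

(** Without edges the exponent is [0^-1 = 0] by convention, so the zero function has norm 1, against
    homogeneity for the scalar 0. *)
Lemma weakly_norming_edges : (0 < #|edges H|)%N.
Proof.
rewrite lt0n; apply/eqP => e0.
have := graph_normZ H_wn 0 (graph_space0 H_wn).
rewrite /graph_norm e0 invr0 !powRr0 normr0 mul0r => /eqP.
by rewrite oner_eq0.
Qed.

(** This isolates what the moduli require: they use the values 1, -1, [eps] and [-eps] of [a]. The
    normalization holds only eventually, once [1 + s k] has positive norm. *)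
Lemma unit_perturbation : exists y : nat -> T * T -> R,
  [/\ graph_space nu H (fun=> 1) /\ graph_norm nu H (fun=> 1) = 1,
      \forall k \near \oo, graph_space nu H (y k) /\ graph_norm nu H (y k) = 1 &
      forall a : R, -1 <= a ->
        graph_norm nu H (fun z => y k z + a) @[k --> \oo] -->
          Num.max (1 + a) 1].
Proof.
have [s sP] := sign_perturbation nu_atomless weakly_norming_edges.
pose W k (a b : R) := fun z => a + b * s k z.
pose N k a b := graph_norm nu H (W k a b).
have WV k a b : graph_space nu H (W k a b) by have [+ _] := sP a b; exact.
have W1 k : W k 1 0 = fun=> 1 by apply/funext => z; rewrite /W mul0r addr0.
have Ncvg a : 0 <= a -> N k a 1 @[k --> \oo] --> Num.max a 1.
  move=> a0; rewrite (_ : Num.max a 1 = (`|a + 1| + `|a - 1|) / 2).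
    by apply: (sP a 1).2; rewrite ltr_wpDr// normr_gt0; lra.
  by rewrite ger0_norm; [case: (lerP a 1) => ?; lra|lra].
have NZ k c a b : N k (c * a) (c * b) = `|c| * N k a b.
  rewrite /N -(graph_normZ H_wn c (WV k a b)); congr (graph_norm _ _ _).
  by apply/funext => z; rewrite /W mulrDr mulrA.
(* For [b = 0] the sequence of norms is constant, so its value equals its limit. *)
have N1 : graph_norm nu H (fun=> 1) = 1.
  have N1cvg := (sP 1 0).2; rewrite addr0 subr0 normr1 divff// in N1cvg.
  have : graph_norm nu H (fun=> 1) @[k --> \oo] --> (1 : R).
    under eq_fun => k do rewrite -(W1 k).
    exact: N1cvg.
  exact: (cvg_unique (@Rhausdorff R) (cvg_cst _)).
(* The norm is 1-Lipschitz in the constant term, which allows that term to vary with [k]. *)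
have Nshift k a a' b : N k a b <= N k a' b + `|a - a'|.
  have := graph_norm_triangle H_wn (WV k a' b) (WV k (a - a') 0).
  rewrite (_ : (fun z => _) = W k a b); last first.
    by apply/funext => z; rewrite /W mul0r addr0 addrAC [a' + _]addrC subrK.
  by have := NZ k (a - a') 1 0; rewrite mulr1 mulr0 /N W1 N1 mulr1 => ->.
pose M k := N k 1 1.
have Mcvg : M k @[k --> \oo] --> (1 : R).
  by have := Ncvg 1 ler01; rewrite maxxx.
have M_gt0 : \forall k \near \oo, 0 < M k by exact: (cvgr_gt _ Mcvg).
exists (fun k => W k (M k)^-1 (M k)^-1); split.
- by split=> //; rewrite -(W1 0%N).
- near=> k; split; first exact: WV.
  have M0 : 0 < M k by near: k.
  have := NZ k (M k)^-1 1 1; rewrite !mulr1 /N => ->.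
  by rewrite gtr0_norm ?invr_gt0// mulVf// gt_eqF.
move=> a a_ge; have a1 : 0 <= 1 + a by rewrite -lerBlDl sub0r.
(* Multiplying [y k + a] by [M k] gives [1 + M k * a + s k]. Its constant term tends to [1 + a]
   because [M k] tends to 1, and [Nshift] bounds the effect of the difference. *)
have numer : N k (1 + M k * a) 1 @[k --> \oo] --> Num.max (1 + a) 1.
  have err0 : `|M k * a - a| @[k --> \oo] --> (0 : R).
    rewrite -[X in _ --> X](normr0 R) -[in X in _ --> X](subrr a).
    apply: cvg_norm; apply: cvgB; last exact: cvg_cst.
    by rewrite -[X in _ --> X]mul1r; apply: cvgM => //; exact: cvg_cst.
  apply: (@squeeze_cvgr _ _ _ _ (fun k => N k (1 + a) 1 - `|M k * a - a|)
      (fun k => N k (1 + a) 1 + `|M k * a - a|)).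
  - apply: nearW => k; apply/andP; split.
      rewrite lerBlDr (le_trans (Nshift k _ (1 + M k * a) 1))// lerD2l distrC.
      by rewrite opprD addrACA subrr add0r.
    rewrite (le_trans (Nshift k _ (1 + a) 1))// lerD2l.
    by rewrite opprD addrACA subrr add0r.
  - by rewrite -[X in _ --> X]subr0; apply: cvgB => //; exact: Ncvg.
  - by rewrite -[X in _ --> X]addr0; apply: cvgD => //; exact: Ncvg.
have quot : (M k)^-1 * N k (1 + M k * a) 1 @[k --> \oo] --> Num.max (1 + a) 1.
  rewrite -[X in _ --> X]mul1r; apply: cvgM => //.
  by rewrite -[X in _ --> X]invr1; apply: cvgV => //; exact: oner_neq0.
apply: cvg_trans quot; apply: near_eq_cvg; near=> k.
have M0 : 0 < M k by near: k.
have MV : `|(M k)^-1| = (M k)^-1 by rewrite gtr0_norm ?invr_gt0.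
transitivity (N k ((M k)^-1 * (1 + M k * a)) ((M k)^-1 * 1)).
  by rewrite NZ MV.
congr (graph_norm _ _ _); apply/funext => z.
by rewrite /W mulr1 mulrDr mulr1 mulrA mulVf ?gt_eqF// mul1r addrAC.
Unshelve. all: by end_near. Qed.

End weakly_norming.

(** * The moduli of convexity and smoothness *)

Section seminorm_moduli.
Context (R : realType) (S : Type) (V : set (S -> R)) (N : (S -> R) -> R).
Context (VD : forall f g, V f -> V g -> V (fun z => f z + g z)).
Context (VZ : forall (c : R) f, V f -> V (fun z => c * f z)).
Context (N_triangle : forall f g, V f -> V g ->
  N (fun z => f z + g z) <= N f + N g).
Context (NZ : forall (c : R) f, V f -> N (fun z => c * f z) = `|c| * N f).

Lemma convexity_modulus_ge0 (eps : R) : (0 <= convexity_modulus V N eps)%E.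
Proof.
apply: le_ereal_inf_tmp => _ [x [x' [xV x'V _ [Nx Nx'] ->]]].
have -> : (fun z => (x z + x' z) / 2) = fun z => 2^-1 * (x z + x' z).
  by apply/funext => z; rewrite mulrC.
rewrite NZ; last exact: VD.
rewrite lee_fin subr_ge0 gtr0_norm// mulrC ler_pdivrMr// mul1r.
by rewrite (le_trans (N_triangle xV x'V))// Nx Nx'.
Qed.

Context (y : nat -> S -> R) (V1 : V (fun=> 1)) (N1 : N (fun=> 1) = 1).
Context (yP : \forall k \near \oo, V (y k) /\ N (y k) = 1).
Context (ycvg : forall a : R, -1 <= a ->
  N (fun z => y k z + a) @[k --> \oo] --> Num.max (1 + a) 1).

Let near_ge (a e v : R) : -1 <= a -> 0 < e -> v = Num.max (1 + a) 1 ->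
  \forall k \near \oo, v - e <= N (fun z => y k z + a).
Proof.
move=> a_ge e_gt0 ->; apply: (cvgr_ge _ (ycvg a_ge)).
by rewrite ltrBlDr ltrDl.
Qed.

Lemma convexity_modulus_eq0 (eps : R) : eps < 1 ->
  convexity_modulus V N eps = 0%E.
Proof.
move=> eps_lt1; apply/eqP; rewrite eq_le convexity_modulus_ge0 andbT.
apply/lee_addgt0Pr => e e_gt0; rewrite add0e.
near \oo => k.
have [yV Ny] : V (y k) /\ N (y k) = 1 by near: k.
(* The limit at [a = -1] is 1, so the slack [1 - eps], positive by hypothesis, leaves a distance of
   at least [eps]. *)
have dist : 1 - (1 - eps) <= N (fun z => y k z - 1).
  by near: k; apply: near_ge; rewrite ?subr_gt0// subrr max_r.
(* The limit at [a = 1] is 2; halving for the midpoint turns the slack [2 * e] into [e]. *)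
have mid : 2 - 2 * e <= N (fun z => y k z + 1).
  by near: k; apply: near_ge; rewrite ?mulr_gt0// ?max_l; lra.
rewrite subKr in dist.
apply: ge_ereal_inf; eexists; first by exists (y k), (fun=> 1).
have -> : (fun z => (y k z + 1) / 2) = fun z => 2^-1 * (y k z + 1).
  by apply/funext => z; rewrite mulrC.
by rewrite NZ; [rewrite lee_fin gtr0_norm//; lra|exact: VD].
Unshelve. all: by end_near. Qed.

Lemma smoothness_modulus_ge (eps : R) : 0 < eps -> eps < 1 ->
  ((2^-1 * eps)%:E <= smoothness_modulus V N eps)%E.
Proof.
move=> eps_gt0 eps_lt1.
have epsE : (fun _ : S => eps * 1) = fun=> eps.
  by apply/funext => z; rewrite mulr1.
have epsV : V (fun=> eps) by have := VZ eps V1; rewrite epsE.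
have Neps : N (fun=> eps) = eps.
  by have := NZ eps V1; rewrite epsE N1 mulr1 gtr0_norm.
apply/lee_addgt0Pr => e e_gt0.
near \oo => k.
have [yV Ny] : V (y k) /\ N (y k) = 1 by near: k.
(* The limits at [eps] and [-eps] are [1 + eps] and 1, whose sum exceeds 2 by [eps]. The two losses
   of [e] are halved to a total of [e]. *)
have sum : 1 + eps - e <= N (fun z => y k z + eps).
  by near: k; apply: near_ge => //; rewrite ?max_l; lra.
have diff : 1 - e <= N (fun z => y k z - eps).
  by near: k; apply: near_ge => //; rewrite ?max_r; lra.
rewrite -leeBlDr// -EFinB.
apply: le_ereal_sup_tmp; eexists; first by exists (y k), (fun=> eps).
by rewrite lee_fin; lra.
Unshelve. all: by end_near. Qed.

End seminorm_moduli.

Theorem theorem2p5 (R : realType) (d : measure_display)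
    (Omega : measurableType d) (nu : probability Omega R)
    (Omega_borel : standard_borel R Omega) (nu_atomless : atomless nu)
    (n : nat) (H : sgraph n) (H_wn : weakly_norming nu H)
    (eps : R) (eps_gt0 : 0 < eps) (eps_lt1 : eps < 1) :
  convexity_modulus (graph_space nu H) (graph_norm nu H) eps = 0%E /\
  ((2^-1 * eps)%:E <=
     smoothness_modulus (graph_space nu H) (graph_norm nu H) eps)%E.
Proof.
have [y [[V1 N1] yP ycvg]] := unit_perturbation nu_atomless H_wn.
split.
  exact: (convexity_modulus_eq0 (graph_spaceD H_wn) (graph_norm_triangle H_wn)
    (graph_normZ H_wn) V1 N1 yP ycvg eps_lt1).
exact: (smoothness_modulus_ge (graph_spaceZ H_wn) (graph_normZ H_wn)
  V1 N1 yP ycvg eps_gt0 eps_lt1).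
Qed.
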